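(* Let the network graph be connected, let $\theta>1$, and couple the step-size to the regularization parameter by $\mu=\eta^{-\theta}$ (equivalently $\eta=\mu^{-1/\theta}$). Assume the algorithm converges, i.e. $\rho(\mathcal{B}')<1$ for all sufficiently large $\eta$ (equivalently, sufficiently small $\mu$). Then the (small step-size expression of the) network mean-square-deviation of the so modified augmented Lagrangian algorithm satisfies, for large $\eta$ or small $\mu$ (i.e. as $\mu\to0^+$), $$\mathrm{MSD}(\mu,\mu^{-1/\theta})=\frac{\mu}{2N}\mathrm{Tr}\Big(\Big(\sum_{k=1}^N R_{u,k}\Big)^{-1}\Big(\sum_{k=1}^N\sigma_{v,k}^2R_{u,k}\Big)\Big)+O\big(\mu^{1+1/\theta}\big).$$
   Context: Graph: $G$ is an undirected graph with nodes $1,\dots,N$ and $E$ edges (self-loops excluded). Its incidence matrix $C\in\mathbb{R}^{E\times N}$ has, in the row of edge $e$, entry $+1$ at the lower-indexed endpoint, $-1$ at the higher-indexed endpoint, and $0$ elsewhere. When $G$ is connected, $C$ has rank $N-1$. Fix a singular value decomposition $C=USV^{T}$ with $U,V$ orthogonal, $V=[\,V_2\ \ \tfrac{1}{\sqrt N}\mathbf 1_N]$, and $S\in\mathbb{R}^{E\times N}$ whose upper-left $(N-1)\times(N-1)$ block $S_2$ is diagonal with the nonzero singular values of $C$, all other entries of $S$ being zero. Put $\mathcal{S}_2=S_2\otimes I_M$, $\mathcal{V}=V\otimes I_M$, $\mathcal{V}_2=V_2\otimes I_M$, $\mathcal{V}_0=\tfrac{1}{\sqrt N}\mathbf 1_N\otimes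 I_M$. Data: for $k=1,\dots,N$, $R_{u,k}\in\mathbb{R}^{M\times M}$ is symmetric positive-semidefinite (regressor covariance), $\sum_k R_{u,k}$ is positive-definite, and $\sigma_{v,k}^2\ge 0$ is the noise variance of agent $k$. Put $\mathcal{H}=\mathrm{blockdiag}\{R_{u,1},\dots,R_{u,N}\}$ and $\mathcal{R}_z=\mathrm{blockdiag}\{\sigma_{v,1}^2R_{u,1},\dots,\sigma_{v,N}^2R_{u,N}\}$. For regularization parameter $\eta>0$ and step-size $\mu>0$ let $\mathcal{B}'=I_{(2N-1)M}-\mu\mathcal{R}'$, $$\mathcal{R}'=\begin{bmatrix}\mathcal{V}_2^{T}\mathcal{H}\mathcal{V}_2+\eta\,\mathcal{S}_2^{T}\mathcal{S}_2 & \mathcal{V}_2^{T}\mathcal{H}\mathcal{V}_0 & \mathcal{S}_2^{T}\\ \mathcal{V}_0^{T}\mathcal{H}\mathcal{V}_2 & \frac1N\sum_{k=1}^N R_{u,k} & 0\\ -\mathcal{S}_2 & 0 & 0\end{bmatrix}.$$ Network MSD: the network mean-square-deviation of the primal-dual algorithm is, in the small step-size (slow adaptation) description in which the random transition matrix is replaced by its mean in the second-moment recursion, given when $\rho(\mathcal{B}')<1$ by $$\mathrm{MSD}(\mu,\eta)=\frac{\mu^2}{N}\sum_{n=0}^\infty\mathrm{Tr}\big(R_h\,(\mathcal{B}'^{T})^{n}\,\Phi\,(\mathcal{B}')^{n}\big),\quad \Phi=\begin{bmatrix}I_{NM}&0\\0&0_{(N-1)M}\end{bmatrix},\quad R_h=\begin{bmatrix}\mathcal{V}^{T}\mathcal{R}_z\mathcal{V}&0\\0&0_{(N-1)M}\end{bmatrix}.$$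 The constant in $O(\cdot)$ may depend on $\theta$, the graph, and the data. *)

(* Defs.v *)
From HB Require Import structures.
From mathcomp Require Export all_boot all_order all_algebra.
From mathcomp Require Export complex mxtens.
From mathcomp Require Export all_classical all_reals all_analysis.

Set Implicit Arguments.
Unset Strict Implicit.
Unset Printing Implicit Defensive.

Export Order.TTheory GRing.Theory Num.Theory.
Export numFieldNormedType.Exports.

Local Open Scope classical_set_scope.
Local Open Scope ring_scope.

(* Each undirected edge is represented once, as (lower endpoint, higher
   endpoint); the rows of the incidence matrix follow the order of [enum]. *)
Definition edges (N : nat) (adj : rel 'I_N) : {set 'I_N * 'I_N} :=
  [set p : 'I_N * 'I_N | (p.1 < p.2)%N && adj p.1 p.2]%SET.

Definition incidence (R : realType) (N : nat) (adj : rel 'I_N) :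
    'M[R]_(#|edges adj|, N) :=
  \matrix_(i, j) let p := enum_val i in
    if j == p.1 then 1 else if j == p.2 then -1 else 0.

Definition graph_connected (N : nat) (adj : rel 'I_N) : Prop :=
  forall i j : 'I_N, connect adj i j.

Definition psdmx (R : realType) (M : nat) (A : 'M[R]_M) : Prop :=
  A^T = A /\ forall x : 'cV[R]_M, 0 <= (x^T *m A *m x) 0 0.

Definition pdmx (R : realType) (M : nat) (A : 'M[R]_M) : Prop :=
  A^T = A /\ forall x : 'cV[R]_M, x != 0 -> 0 < (x^T *m A *m x) 0 0.

(* Largest modulus of a complex eigenvalue (0 for the empty matrix). *)
Definition spectral_radius (R : realType) (m : nat) (A : 'M[R]_m) : R :=
  sup [set ComplexField.Normc.normc z | z in
        [set z : R[i] | eigenvalue (map_mx (real_complex R) A) z]].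

Section SVD.
Variables (R : realType) (N E : nat).

Definition orthogonal_mx (m n : nat) (A : 'M[R]_(m, n)) : Prop :=
  A^T *m A = 1%:M /\ A *m A^T = 1%:M.

(* The column 1_N / sqrt N. *)
Definition unit_ones : 'cV[R]_N := const_mx (Num.sqrt N%:R)^-1.

(* V = [V2  1_N / sqrt N]; its width N.-1 + 1 equals N when 0 < N. *)
Definition Vmx (V2 : 'M[R]_(N, N.-1)) : 'M[R]_(N, N.-1 + 1) :=
  row_mx V2 unit_ones.

(* E x N matrix with diag_mx s as its upper-left block, 0 elsewhere. *)
Definition Smx (s : 'rV[R]_N.-1) : 'M[R]_(E, N.-1 + 1) :=
  row_mx (\matrix_(i < E, j < N.-1) if i == j :> nat then s 0 j else 0) 0.

(* C = U S V^T is a singular value decomposition with V = [V2  1_N / sqrt N]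
   and nonzero singular values s. *)
Definition is_svd (C : 'M[R]_(E, N)) (U : 'M[R]_E) (s : 'rV[R]_N.-1)
    (V2 : 'M[R]_(N, N.-1)) : Prop :=
  [/\ orthogonal_mx U, orthogonal_mx (Vmx V2), forall j, 0 < s 0 j
    & C = U *m Smx s *m (Vmx V2)^T].

End SVD.

Section Algorithm.
Variables (R : realType) (N M : nat).

(* blockdiag {A_1, ..., A_N}, indexed as in the Kronecker product *t. *)
Definition blockdiag (A : 'I_N -> 'M[R]_M) : 'M[R]_(N * M) :=
  \sum_k (delta_mx k k : 'M[R]_N) *t A k.

Variables (s : 'rV[R]_N.-1) (V2 : 'M[R]_(N, N.-1)).

Definition calS2 : 'M[R]_(N.-1 * M) := diag_mx s *t (1%:M : 'M[R]_M).

Definition calV2 : 'M[R]_(N * M, N.-1 * M) := V2 *t (1%:M : 'M[R]_M).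

(* The cast identifies the width 1 * M with M. *)
Definition calV0 : 'M[R]_(N * M, M) :=
  castmx (erefl, mul1n M) (unit_ones R N *t (1%:M : 'M[R]_M)).

(* V (x) I_M, with its columns split as those of V = [V2  1_N / sqrt N]. *)
Definition calV : 'M[R]_(N * M, N.-1 * M + M) := row_mx calV2 calV0.

Variables (Ru : 'I_N -> 'M[R]_M) (sigma2 : 'I_N -> R).

Definition calH : 'M[R]_(N * M) := blockdiag Ru.

Definition calRz : 'M[R]_(N * M) := blockdiag (fun k => sigma2 k *: Ru k).

Definition calR' (eta : R) : 'M[R]_(N.-1 * M + M + N.-1 * M) :=
  block_mx
    (block_mx (calV2^T *m calH *m calV2 + eta *: (calS2^T *m calS2))
              (calV2^T *m calH *m calV0)
              (calV0^T *m calH *m calV2)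
              (N%:R^-1 *: \sum_k Ru k))
    (col_mx calS2^T 0)
    (row_mx (- calS2) 0)
    0.

Definition calB' (mu eta : R) : 'M[R]_(N.-1 * M + M + N.-1 * M) :=
  1%:M - mu *: calR' eta.

Definition Phi : 'M[R]_(N.-1 * M + M + N.-1 * M) := block_mx 1%:M 0 0 0.

Definition Rh : 'M[R]_(N.-1 * M + M + N.-1 * M) :=
  block_mx (calV^T *m calRz *m calV) 0 0 0.

(* Meaningful when spectral_radius (calB' mu eta) < 1. *)
Definition MSD (mu eta : R) : R :=
  mu ^+ 2 / N%:R *
  limn [series
    \tr (Rh *m (calB' mu eta)^T ^+ n *m Phi *m calB' mu eta ^+ n)]_n.

End Algorithm.

(* Main.v *)
(* Split the state as x = (w1, w0, l), following the blocks of R', and let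
   x_(n+1) = B' x_n with l_0 = 0: the MSD is a linear combination of sums of
   |w1|^2 + |w0|^2 along such trajectories.  Two quadratic forms control these
   sums.
   - L(x) = |x|^2 + kappa eta |l + S^-T w1 / eta|^2 decreases by at least
     c mu (eta |w1|^2 + |w0|^2 + |l|^2) in each step once mu eta is small, and
     L(x_0) = O(|x_0|^2) because l_0 = 0.  The second term is needed since l
     alone decays only at rate mu / eta.
   - J(x) = <w0, P w0> - (2 / eta) <w0, Y w1>, with P the inverse of the mean
     covariance, A01 the (w0, w1) block of R' and Y = P A01 (S^T S)^-1,
     decreases by 2 mu (|w1|^2 + |w0|^2) up to O(1 / eta) times the decrease
     of L.
   Telescoping gives
     2 mu sum_n (|w1|^2 + |w0|^2) = <w0, P w0> + O(|x_0|^2 / eta)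
   (w0 at time 0 on the right), and polarization turns this into the estimate
   of the trace.  With mu = eta^-theta and theta > 1, mu eta tends to 0.  The
   decrease of L also gives the convergence of the series. *)

Require Import Defs.
From mathcomp Require Import ring lra.

Set Implicit Arguments.
Unset Strict Implicit.
Unset Printing Implicit Defensive.

Local Open Scope classical_set_scope.
Local Open Scope ring_scope.

(** * Scalar products, Young's inequality and matrix bounds *)

Section DotProduct.
Variable R : realFieldType.

Definition dot (n : nat) (x y : 'cV[R]_n) : R := (x^T *m y) 0 0.
Definition sq (n : nat) (x : 'cV[R]_n) : R := dot x x.

Lemma dotE n (x y : 'cV[R]_n) : dot x y = \sum_i x i 0 * y i 0.
Proof. by rewrite /dot mxE; apply: eq_bigr => i _; rewrite mxE. Qed.

Lemma dotC n (x y : 'cV[R]_n) : dot x y = dot y x.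
Proof. by rewrite !dotE; apply: eq_bigr => i _; rewrite mulrC. Qed.

Lemma dotDr n (x y z : 'cV[R]_n) : dot x (y + z) = dot x y + dot x z.
Proof. by rewrite /dot mulmxDr mxE. Qed.

Lemma dotZr n a (x y : 'cV[R]_n) : dot x (a *: y) = a * dot x y.
Proof. by rewrite /dot -scalemxAr mxE. Qed.

Lemma dotNr n (x y : 'cV[R]_n) : dot x (- y) = - dot x y.
Proof. by rewrite -scaleN1r dotZr mulN1r. Qed.

Lemma dotDl n (x y z : 'cV[R]_n) : dot (y + z) x = dot y x + dot z x.
Proof. by rewrite dotC dotDr !(dotC x). Qed.

Lemma dotZl n a (x y : 'cV[R]_n) : dot (a *: y) x = a * dot y x.
Proof. by rewrite dotC dotZr dotC. Qed.

Lemma dotNl n (x y : 'cV[R]_n) : dot (- y) x = - dot y x.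
Proof. by rewrite dotC dotNr dotC. Qed.

Definition dotL := (dotDr, dotDl, dotNr, dotNl, dotZr, dotZl).

Lemma dot_mulmxl m n (A : 'M[R]_(m, n)) x y :
  dot (A *m x) y = dot x (A^T *m y).
Proof. by rewrite /dot trmx_mul mulmxA. Qed.

Lemma sq_ge0 n (x : 'cV[R]_n) : 0 <= sq x.
Proof. by rewrite /sq dotE sumr_ge0 // => i _; rewrite -expr2 sqr_ge0. Qed.

Lemma sq_eq0 n (x : 'cV[R]_n) : sq x = 0 -> x = 0.
Proof.
rewrite /sq dotE => /eqP.
rewrite psumr_eq0 => [|i _]; last by rewrite -expr2 sqr_ge0.
move=> /allP x0; apply/colP => i; rewrite mxE.
by have := x0 i (mem_index_enum i); rewrite mulf_eq0 orbb => /eqP.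
Qed.

Lemma sq_col_mx m n (x : 'cV[R]_m) (y : 'cV[R]_n) :
  sq (col_mx x y) = sq x + sq y.
Proof. by rewrite /sq /dot tr_col_mx mul_row_col mxE. Qed.

Lemma sqD_le n (x y : 'cV[R]_n) : sq (x + y) <= 2 * sq x + 2 * sq y.
Proof. by have := sq_ge0 (x - y); rewrite /sq !dotL (dotC y x); lra. Qed.

Lemma sqD3_le n (x y z : 'cV[R]_n) :
  sq (x + y + z) <= 3 * (sq x + sq y + sq z).
Proof.
have := sq_ge0 (x - y); have := sq_ge0 (x - z); have := sq_ge0 (y - z).
by rewrite /sq !dotL (dotC y x) (dotC z x) (dotC z y); lra.
Qed.

Lemma sqZ n a (x : 'cV[R]_n) : sq (a *: x) = a ^+ 2 * sq x.
Proof. by rewrite /sq !dotL; ring. Qed.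

(** Expand t^-1 |t x - y|^2 >= 0, then replace y by -y to reach the absolute value. *)
Lemma dot_young n t (x y : 'cV[R]_n) : 0 < t ->
  2 * `|dot x y| <= t * sq x + t^-1 * sq y.
Proof.
move=> t0; have ti : t * t^-1 = 1 by rewrite mulfV ?gt_eqF.
have key (u : 'cV[R]_n) : 2 * dot x u <= t * sq x + t^-1 * sq u.
  have tv0 : 0 <= t^-1 by rewrite invr_ge0 ltW.
  have := mulr_ge0 tv0 (sq_ge0 (t *: x - u)).
  rewrite {1}/sq !dotL (dotC u x) -/(sq x) -/(sq u).
  set a := sq x; set b := sq u; set d := dot x u => h.
  have -> : t * a = (t * t^-1) * t * a by rewrite ti mul1r.
  have -> : 2 * d = 2 * (t * t^-1) * d by rewrite ti mulr1.
  by nra.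
have [_|_] := ger0P (dot x y); first exact: key.
by have := key (- y); rewrite dotNr /sq dotNl dotNr opprK.
Qed.

Lemma dot_norm_le n (x y : 'cV[R]_n) : 2 * `|dot x y| <= sq x + sq y.
Proof. by have := dot_young x y ltr01; rewrite invr1 !mul1r. Qed.

Lemma cauchy_schwarz n (x y : 'cV[R]_n) : dot x y ^+ 2 <= sq x * sq y.
Proof.
have := sq_ge0 y; rewrite le_eqVlt => /predU1P[/esym y0|y0].
  by rewrite y0 (sq_eq0 y0) /dot mulmx0 mxE expr0n mulr0.
have := sq_ge0 (sq y *: x - dot x y *: y).
rewrite {1}/sq !dotL (dotC y x) -/(sq x) -/(sq y).
set a := sq x; set b := sq y; set d := dot x y => h.
rewrite -(ler_pM2l y0) -/b; lra.
Qed.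

Lemma sq_mulmx_bound m n (A : 'M[R]_(m, n)) :
  exists2 K, 0 <= K & forall x, sq (A *m x) <= K * sq x.
Proof.
(* The squared Frobenius norm: Cauchy-Schwarz is applied row by row. *)
exists (\sum_i sq (row i A)^T) => [|x].
  by apply: sumr_ge0 => i _; apply: sq_ge0.
rewrite {1}/sq dotE mulr_suml; apply: ler_sum => i _.
have -> : (A *m x) i 0 = dot (row i A)^T x.
  by rewrite /dot trmxK -row_mul [RHS]mxE.
by rewrite -expr2 cauchy_schwarz.
Qed.

Lemma sq_mulmx_lower n (A : 'M[R]_n) : A \in unitmx ->
  exists2 c, 0 < c & forall x, c * sq x <= sq (A *m x).
Proof.
move=> Au; have [K K0 hK] := sq_mulmx_bound (invmx A).
have K1 : 0 < K + 1 by rewrite ltr_wpDl.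
(* Adding 1 keeps the inverse meaningful when K = 0, which can happen in dimension 0. *)
exists (K + 1)^-1; first by rewrite invr_gt0.
move=> x; rewrite ler_pdivrMl //; have := hK (A *m x); rewrite mulKmx // => h.
by apply: (le_trans h); rewrite ler_wpM2r ?sq_ge0 // lerDl.
Qed.

Lemma pos_def_unitmx n (A : 'M[R]_n) :
  (forall x, x != 0 -> 0 < dot x (A *m x)) -> A \in unitmx.
Proof.
move=> Apos; rewrite -unitmx_tr -row_free_unit -kermx_eq0.
apply/rowV0P => v /sub_kermxP vA; apply/eqP/negPn/negP => v0.
have := Apos v^T; rewrite -trmx_eq0 in v0; move=> /(_ v0).
have -> : A *m v^T = 0 by rewrite -[A]trmxK -trmx_mul vA trmx0.
by rewrite /dot mulmx0 mxE ltxx.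
Qed.

(* With |A^-1 x|^2 <= K |x|^2, expanding <y, A y> >= 0 at y = x - t A^-1 x
   for small t bounds <x, A x> from below, without any compactness. *)
Lemma pos_def_coercive n (A : 'M[R]_n) : A^T = A ->
  (forall x, x != 0 -> 0 < dot x (A *m x)) ->
  exists2 c, 0 < c & forall x, c * sq x <= dot x (A *m x).
Proof.
move=> As Apos; have Au := pos_def_unitmx Apos.
have Age x : 0 <= dot x (A *m x).
  have [->|/Apos/ltW//] := eqVneq x 0; by rewrite mulmx0 /dot mulmx0 mxE.
have [K K0 hK] := sq_mulmx_bound (invmx A).
set t := (K + 1)^-1.
have K1 : 0 < K + 1 by rewrite ltr_wpDl.
have t0 : 0 < t by rewrite invr_gt0.
have tK : t * (K + 1) = 1 by rewrite mulVf ?gt_eqF.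
exists t => // x; set y := invmx A *m x.
have Ay : A *m y = x by rewrite mulKVmx.
have := Age (x - t *: y); rewrite mulmxBr -scalemxAr Ay !dotL.
have -> : dot y (A *m x) = sq x by rewrite /sq -[in RHS]Ay dot_mulmxl As Ay.
rewrite -/(sq x) => pos.
have yx : 2 * dot y x <= (K + 1) * sq x.
  have := dot_norm_le y x; have := hK x; have := ler_norm (dot y x).
  by rewrite -/y; lra.
have : t * t * (2 * dot y x) <= t * sq x.
  have -> : t * sq x = t * t * ((K + 1) * sq x).
    by rewrite mulrA -(mulrA t t) tK mulr1.
  by rewrite ler_wpM2l ?mulr_ge0 ?(ltW t0).
have := mulr_ge0 (ltW t0) (sq_ge0 x).
by lra.
Qed.

Lemma dot_bounds n t (x y : 'cV[R]_n) : 0 < t ->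
  - (t * sq x + t^-1 * sq y) <= 2 * dot x y <= t * sq x + t^-1 * sq y.
Proof.
by move=> t0; rewrite -ler_norml normrM (ger0_norm (ler0n _ _)) dot_young.
Qed.

Lemma sq_subZ n t (x y : 'cV[R]_n) :
  sq (x - t *: y) = sq x - t * (2 * dot x y - t * sq y).
Proof. by rewrite /sq !dotL (dotC y x); ring. Qed.

End DotProduct.

(** * Series: telescoping and polarization *)

Section Limits.
Variable R : realType.

(** The decrease of L serves twice: it dominates the partial sums of f, and it pays for the error
    made when the increments of j are read as m f. The bound of |j| by k f makes j vanish at
    infinity, so that only j 0 survives. *)
Lemma telescoping_estimate (f j L : nat -> R) (a e k m : R) :
  0 < a -> 0 <= e -> (forall n, 0 <= f n) -> (forall n, 0 <= L n) ->
  (forall n, a * f n <= L n - L n.+1) ->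
  (forall n, `|j n - j n.+1 - m * f n| <= e * (L n - L n.+1)) ->
  (forall n, `|j n| <= k * f n) ->
  cvgn (series f) /\ `|m * limn (series f) - j 0| <= e * L 0.
Proof.
move=> a0 e0 f0 L0 Lf jf jk.
have cf : cvgn (series f).
  apply: nondecreasing_is_cvgn; first exact: nondecreasing_series.
  exists (a^-1 * L 0) => _ [n _ <-].
  rewrite ler_pdivlMl //.
  suff : a * series f n <= L 0 - L n by move/le_trans; apply; rewrite gerBl.
  elim: n => [|n IH]; first by rewrite /series /= big_geq // mulr0 subrr.
  have := Lf n; rewrite seriesSr mulrDr; lra.
split=> //.
have j0 : j n @[n --> \oo] --> 0.
  apply: norm_cvg0.
  have kf : (k * f n) @[n --> \oo] --> 0.
    by rewrite -(mulr0 k); apply: cvgMr; exact: cvg_series_cvg_0.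
  apply: (squeeze_cvgr _ (cvg_cst 0) kf).
  by apply: nearW => n; rewrite normr_ge0 jk.
have est n : `|j 0 - j n - m * series f n| <= e * (L 0 - L n).
  elim: n => [|n IH].
    by rewrite /series /= big_geq // mulr0 !subrr normr0 mulr0.
  have -> : j 0 - j n.+1 - m * series f n.+1 =
      (j 0 - j n - m * series f n) + (j n - j n.+1 - m * f n).
    by rewrite seriesSr; ring.
  by apply: le_trans (ler_normD _ _) _; have := jf n; lra.
have lim_est : `|j 0 - j n - m * series f n| @[n --> \oo] -->
    `|j 0 - 0 - m * limn (series f)|.
  apply: cvg_norm; apply: cvgB; last by apply: cvgMr.
  by apply: cvgB => //; apply: cvg_cst.
rewrite distrC -[j 0]subr0.
apply: (ler_cvg_to lim_est (cvg_cst (e * L 0))).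
apply: nearW => n; apply: le_trans (est n) _.
by rewrite ler_wpM2l // gerBl.
Qed.

Lemma sym_polarization m (W : 'M[R]_m) (i j : 'I_m) : W^T = W ->
  let e k : 'cV[R]_m := delta_mx k 0 in
  W j i = 4^-1 * (dot (e i + e j) (W *m (e i + e j))
                  - dot (e i - e j) (W *m (e i - e j))).
Proof.
move=> Ws e.
have dW (k l : 'I_m) : dot (e k) (W *m e l) = W k l.
  by rewrite /dot /e trmx_delta -rowE -colE !mxE.
rewrite mulmxDr mulmxBr !dotDl !dotDr !dotNl !dotNr !dW.
have -> : W i j = W j i by rewrite -[in LHS]Ws mxE.
by field.
Qed.

(** Polarization turns the estimates for quadratic forms into convergence and an error bound for
    every entry of the summed matrices; the trace is a finite linear combination of these entries
    with coefficients from K. *)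
Lemma trace_series_estimate m (K Q : 'M[R]_m) (Z : nat -> 'M[R]_m) (t e : R) :
  Q^T = Q -> (forall n, (Z n)^T = Z n) ->
  (forall y : 'cV[R]_m, let f := series (fun n => dot y (Z n *m y)) in
     cvgn f /\ `|t * limn f - dot y (Q *m y)| <= e * sq y) ->
  `|t * limn (series (fun n => \tr (K *m Z n))) - \tr (K *m Q)|
    <= e * \sum_i \sum_j `|K i j|.
Proof.
move=> Qs Zs est.
pose lm y := limn (series (fun n => dot y (Z n *m y))).
pose v k : 'cV[R]_m := delta_mx k 0.
pose W i j := 4^-1 * (lm (v i + v j) - lm (v i - v j)).
have trE (V : 'M[R]_m) : \tr (K *m V) = \sum_i \sum_j K i j * V j i.
  by apply: eq_bigr => i _; rewrite mxE.
have cvW i j : series (fun n => Z n j i) n @[n --> \oo] --> W i j.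
  have -> : series (fun n => Z n j i) = (fun n => 4^-1 *
    (series (fun n => dot (v i + v j) (Z n *m (v i + v j))) n
     - series (fun n => dot (v i - v j) (Z n *m (v i - v j))) n)).
    apply/funext => n; rewrite /series /= -sumrB mulr_sumr.
    by apply: eq_bigr => k _; rewrite (sym_polarization _ _ (Zs k)).
  by apply: cvgMr; apply: cvgB; apply: (est _).1.
have cvT : series (fun n => \tr (K *m Z n)) n @[n --> \oo] -->
    \sum_i \sum_j K i j * W i j.
  have -> : series (fun n => \tr (K *m Z n)) =
      (fun n => \sum_i \sum_j K i j * series (fun n => Z n j i) n).
    apply/funext => n; rewrite /series /=.
    under eq_bigr do rewrite trE.
    rewrite exchange_big; apply: eq_bigr => i _ /=.
    rewrite exchange_big; apply: eq_bigr => j _ /=.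
    by rewrite mulr_sumr.
  apply: cvg_big => [|i _]; first exact: add_continuous.
  apply: cvg_big => [|j _]; first exact: add_continuous.
  by apply: cvgMr; exact: cvW.
rewrite (cvg_lim _ cvT) //.
rewrite trE mulr_sumr -sumrB mulr_sumr.
apply: le_trans (ler_norm_sum _ _ _) _; apply: ler_sum => i _.
rewrite !mulr_sumr -sumrB.
apply: le_trans (ler_norm_sum _ _ _) _; apply: ler_sum => j _.
rewrite mulrCA -mulrBr normrM mulrC ler_wpM2r //.
rewrite (sym_polarization _ _ Qs) -/(v i) -/(v j).
have [_ ep] := est (v i + v j); have [_ em] := est (v i - v j).
rewrite /W -/(lm (v i + v j)) in ep *; rewrite -/(lm (v i - v j)) in em.
(* By the parallelogram law |v i + v j|^2 + |v i - v j|^2 = 4, also for i = j, so every entry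
   inherits the error e. *)
have -> : e = 4^-1 * (e * sq (v i + v j) + e * sq (v i - v j)).
  have vv k : dot (v k) (v k) = 1.
    by rewrite /dot /v trmx_delta mul_delta_mx mxE !eqxx.
  rewrite /sq !dotDl !dotDr !dotNl !dotNr !vv (dotC (v j)).
  by field.
have -> : t * (4^-1 * (lm (v i + v j) - lm (v i - v j))) - 4^-1 *
    (dot (v i + v j) (Q *m (v i + v j)) - dot (v i - v j) (Q *m (v i - v j)))
  = 4^-1 * ((t * lm (v i + v j) - dot (v i + v j) (Q *m (v i + v j)))
    - (t * lm (v i - v j) - dot (v i - v j) (Q *m (v i - v j)))) by ring.
rewrite normrM gtr0_norm ?invr_gt0 // ler_wpM2l ?invr_ge0 //.
by apply: le_trans (ler_normB _ _) _; rewrite lerD.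
Qed.

End Limits.

(** * The primal-dual iteration with abstract blocks *)

Section SaddlePoint.
Variables (R : realType) (p q : nat).
Variables (A11 : 'M[R]_p) (A10 : 'M[R]_(p, q)).
Variables (A01 : 'M[R]_(q, p)) (A00 : 'M[R]_q) (S : 'M[R]_p).
Hypothesis S_unit : S \in unitmx.
Hypothesis A00_sym : A00^T = A00.
Hypothesis A00_pos : forall x, x != 0 -> 0 < dot x (A00 *m x).

Definition drift1 (w1 : 'cV[R]_p) (w0 : 'cV[R]_q) := A11 *m w1 + A10 *m w0.
Definition drift0 (w1 : 'cV[R]_p) (w0 : 'cV[R]_q) := A01 *m w1 + A00 *m w0.

Definition step1 mu eta w1 w0 l :=
  w1 - mu *: (drift1 w1 w0 + eta *: (S^T *m (S *m w1)) + S^T *m l).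
Definition step0 mu w1 w0 := w0 - mu *: drift0 w1 w0.
Definition stepl mu w1 (l : 'cV[R]_p) := l + mu *: (S *m w1).

Definition invS_tr := (invmx S)^T.

(* [slow eta w1 l] is the slow mode: the leading terms S w1 in the increments
   of l and of eta^-1 S^-T w1 cancel, so it varies at rate mu / eta only. *)
Definition slow eta w1 (l : 'cV[R]_p) := l + eta^-1 *: (invS_tr *m w1).

Definition lyap kappa eta w1 (w0 : 'cV[R]_q) l :=
  sq w1 + sq w0 + sq l + kappa * eta * sq (slow eta w1 l).

(** The weight eta on |w1|^2 comes from the penalty eta S^T S. The term |l|^2 has no such weight: it
    stems from eta |[slow]|^2, which decays only at the relative rate mu / eta. *)
Definition dissip eta (w1 : 'cV[R]_p) (w0 : 'cV[R]_q) (l : 'cV[R]_p) :=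
  eta * sq w1 + sq w0 + sq l.

Let P := invmx A00.
Definition couple := P *m A01 *m invmx S *m invS_tr.

(* <w0, A00^-1 w0> solves the Lyapunov equation of the w0-block; the second
   term cancels the first-order effect of w1 on it. *)
Definition corrector eta w1 w0 :=
  dot w0 (P *m w0) - 2 * eta^-1 * dot w0 (couple *m w1).

(** * Block identities and the decrease of the Lyapunov function *)

Lemma invS_trK : invS_tr *m S^T = 1%:M.
Proof. by rewrite -trmx_mul mulmxV // trmx1. Qed.

(** This equation dictates [couple]: the penalty part eta S^T S w1 of the step of w1, scaled by
    eta^-1 and sent through [couple], becomes P A01 w1, the term to be cancelled in the change of
    <w0, P w0>. *)
Lemma coupleK : couple *m S^T *m S = P *m A01.
Proof. by rewrite -mulmxA -mulmxA (mulmxA invS_tr) invS_trK mul1mx mulmxKV. Qed.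

Lemma A00_unit : A00 \in unitmx.
Proof. exact: pos_def_unitmx. Qed.

(** One upper constant K and one lower constant c serve all blocks, normalised to K >= 1 and c <= 1,
    so that the later estimates need no other data of the matrices. *)
Lemma block_bounds : exists K c, [/\ 1 <= K, 0 < c & c <= 1] /\
  (forall w1 w0,
    [/\ sq (drift1 w1 w0) <= K * (sq w1 + sq w0),
        sq (drift0 w1 w0) <= K * (sq w1 + sq w0),
        sq (A01 *m w1) <= K * sq w1,
        c * sq w1 <= sq (S *m w1)
      & c * sq w0 <= dot w0 (A00 *m w0)]) /\
  (forall x,
    [/\ sq (S *m x) <= K * sq x,
        sq (S^T *m x) <= K * sq x,
        sq (S^T *m (S *m x)) <= K * sq x
      & sq (invS_tr *m x) <= K * sq x]) /\
  (forall x,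
    [/\ sq (couple *m x) <= K * sq x
      & sq (couple *m (S^T *m x)) <= K * sq x]) /\
  (forall x, sq (P *m x) <= K * sq x).
Proof.
have [c1 c1_gt0 h1] := sq_mulmx_lower S_unit.
have [c2 c2_gt0 h2] := pos_def_coercive A00_sym A00_pos.
have [k1 k1_ge0 b1] := sq_mulmx_bound (row_mx A11 A10).
have [k2 k2_ge0 b2] := sq_mulmx_bound (row_mx A01 A00).
have [k3 k3_ge0 b3] := sq_mulmx_bound A01.
have [k4 k4_ge0 b4] := sq_mulmx_bound S.
have [k5 k5_ge0 b5] := sq_mulmx_bound S^T.
have [k6 k6_ge0 b6] := sq_mulmx_bound (S^T *m S).
have [k7 k7_ge0 b7] := sq_mulmx_bound invS_tr.
have [k8 k8_ge0 b8] := sq_mulmx_bound couple.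
have [k9 k9_ge0 b9] := sq_mulmx_bound (couple *m S^T).
have [k0 k0_ge0 b0] := sq_mulmx_bound P.
pose K := 1 + k1 + k2 + k3 + k4 + k5 + k6 + k7 + k8 + k9 + k0.
pose c := Num.min 1 (Num.min c1 c2).
have wK n (x : 'cV[R]_n) y k : 0 <= k <= K -> y <= k * sq x -> y <= K * sq x.
  case/andP=> _ kK yk; apply: le_trans yk _.
  by rewrite ler_wpM2r ?sq_ge0.
have wc n (x : 'cV[R]_n) y k : c <= k -> k * sq x <= y -> c * sq x <= y.
  by move=> ck; apply: le_trans; rewrite ler_wpM2r ?sq_ge0.
have [cc1 cc2] : c <= c1 /\ c <= c2 by rewrite /c !ge_min !lexx !orbT.
exists K, c; split; first split.
- by rewrite /K; lra.
- by rewrite /c !lt_min c1_gt0 c2_gt0 ltr01.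
- by rewrite /c ge_min lexx.
split=> [w1 w0|]; first split.
- rewrite -sq_col_mx /drift1 -mul_row_col; apply: wK (b1 _).
  by rewrite k1_ge0 /K /=; lra.
- rewrite -sq_col_mx /drift0 -mul_row_col; apply: wK (b2 _).
  by rewrite k2_ge0 /K /=; lra.
- by apply: wK (b3 _); rewrite k3_ge0 /K /=; lra.
- exact: wc (h1 _).
- exact: wc (h2 _).
split=> [x|]; first split.
- by apply: wK (b4 _); rewrite k4_ge0 /K /=; lra.
- by apply: wK (b5 _); rewrite k5_ge0 /K /=; lra.
- by rewrite mulmxA; apply: wK (b6 _); rewrite k6_ge0 /K /=; lra.
- by apply: wK (b7 _); rewrite k7_ge0 /K /=; lra.
split=> [x|x]; first split.
- by apply: wK (b8 _); rewrite k8_ge0 /K /=; lra.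
- by rewrite mulmxA; apply: wK (b9 _); rewrite k9_ge0 /K /=; lra.
- by apply: wK (b0 _); rewrite k0_ge0 /K /=; lra.
Qed.

(** What survives the cancellation is -(mu / eta) l plus a drift term: the restoring force on l that
    the plain energy lacks. *)
Lemma slow_step mu eta w1 w0 l : eta != 0 ->
  slow eta (step1 mu eta w1 w0 l) (stepl mu w1 l) =
  slow eta w1 l - (mu / eta) *: (l + invS_tr *m drift1 w1 w0).
Proof.
move=> eta0; rewrite /slow /step1 /stepl mulmxBr -!scalemxAr !mulmxDr.
rewrite -!scalemxAr !(mulmxA invS_tr) invS_trK !mul1mx.
move: (S *m w1) (invS_tr *m w1) (invS_tr *m drift1 w1 w0) => u v w.
apply/colP => i; rewrite !mxE; field.
exact: eta0.
Qed.

(** The coupling of w1 and l is skew, so the first-order terms in <S w1, l> from the two steps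
    cancel. Hence |l|^2 gets no damping at first order. *)
Lemma energy_step mu eta w1 w0 l :
  sq w1 + sq w0 + sq l - (sq (step1 mu eta w1 w0 l) + sq (step0 mu w1 w0)
    + sq (stepl mu w1 l)) =
  mu * (2 * dot w1 (drift1 w1 w0) + 2 * eta * sq (S *m w1)
        + 2 * dot w0 (A01 *m w1) + 2 * dot w0 (A00 *m w0))
  - mu ^+ 2 * (sq (drift1 w1 w0 + eta *: (S^T *m (S *m w1)) + S^T *m l)
        + sq (S *m w1) + sq (drift0 w1 w0)).
Proof.
rewrite /step1 /step0 /stepl.
set a := _ + S^T *m l.
have w1a : dot w1 a = dot w1 (drift1 w1 w0) + eta * sq (S *m w1)
    + dot (S *m w1) l.
  by rewrite /a !dotL -!dot_mulmxl.
have w0r : dot w0 (drift0 w1 w0) = dot w0 (A01 *m w1) + dot w0 (A00 *m w0).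
  by rewrite /drift0 dotL.
have -> : l + mu *: (S *m w1) = l - (- mu) *: (S *m w1).
  by rewrite scaleNr opprK.
rewrite !sq_subZ w1a w0r (dotC l).
by ring.
Qed.

(** The energy damps w1 and w0, the slow mode damps l. The constants are fixed in turn: kappa
    against the slow-mode errors, delta against the mu^2 terms, eta0 against the cross terms of
    w1. *)
Lemma lyapunov_decrease : exists c kappa delta eta0,
  [/\ 0 < c, 0 < kappa, 0 < delta <= 1 & 1 <= eta0] /\
  forall mu eta w1 w0 l, eta0 <= eta -> 0 < mu -> mu * eta <= delta ->
    c * (mu * dissip eta w1 w0 l) <= lyap kappa eta w1 w0 l
      - lyap kappa eta (step1 mu eta w1 w0 l) (step0 mu w1 w0) (stepl mu w1 l).
Proof.
have [K [c [[K1 c0 c1] [B1 [B2 _]]]]] := block_bounds.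
have K0 : 0 < K by lra.
have Kn0 : K != 0 by rewrite gt_eqF.
have cn0 : c != 0 by rewrite gt_eqF.
(* Weight of Young's inequality for <w1, [drift1]>, chosen so that M^-1 K = c / 4. *)
pose M := 4 * K / c.
have M0 : 0 < M by rewrite /M divr_gt0 // mulr_gt0.
have ME : M = 4 * K / c by [].
clearbody M.
(* With this kappa the slow-mode error 5 K^2 (|w1|^2 + |w0|^2) costs c / 4 times that sum. *)
pose kappa := c / (20 * K ^+ 2).
have kap0 : 0 < kappa by rewrite /kappa divr_gt0 // mulr_gt0 // exprn_gt0.
have kapK : kappa * (5 * K ^+ 2) = c / 4 by rewrite /kappa; field.
have kapc : kappa <= c / 20.
  rewrite /kappa ler_pdivrMr ?mulr_gt0 ?exprn_gt0 //.
  have : c * 1 <= c * K ^+ 2 by rewrite ler_wpM2l ?exprn_ege1 // ltW.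
  by lra.
(* Makes the second-order loss 9 K delta equal to kappa / 8. *)
pose delta := kappa / (72 * K).
have delta0 : 0 < delta by rewrite /delta divr_gt0 // mulr_gt0.
have deltaK : 9 * K * delta = kappa / 8 by rewrite /delta; field.
have delta1 : delta <= 1.
  by rewrite /delta ler_pdivrMr ?mulr_gt0 //; lra.
(* The 2 gives mu / eta <= 1 / 2; the quotient lets c eta absorb the amount c / 4 + 2 M of |w1|^2
   spent in Young's inequality. *)
pose eta0 := 2 + (c / 4 + 2 * M) / c.
(* Of the damping kappa / 4 on |l|^2, half is left after the second-order terms. *)
exists (kappa / 8), kappa, delta, eta0; split.
  split=> //; first by rewrite divr_gt0.
    by rewrite delta0.
  rewrite /eta0 ler_wpDr ?ler1n // divr_ge0 ?(ltW c0) //.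
  by lra.
move=> mu eta w1 w0 l eta_ge mu0 mueta.
have e0c : c * eta0 = 2 * c + (c / 4 + 2 * M) by rewrite /eta0; field.
have eta2 : 2 <= eta.
  apply: le_trans eta_ge; rewrite /eta0 lerDl divr_ge0 ?(ltW c0) //.
  by lra.
have etac : c / 4 + 2 * M <= c * eta.
  have : c * eta0 <= c * eta by rewrite ler_wpM2l // ltW.
  by lra.
have eta0' : 0 < eta by lra.
have etan0 : eta != 0 by rewrite gt_eqF.
have [dr1 dr0 da01 sS d00] := B1 w1 w0.
have [Sw1 _ SSw1 Tw1] := B2 w1.
have [_ Sl _ _] := B2 l.
have [_ _ _ Tr] := B2 (drift1 w1 w0).
rewrite /lyap slow_step //.
have es := energy_step mu eta w1 w0 l.
set z := slow eta w1 l; set b := l + invS_tr *m drift1 w1 w0.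
(* The direction b of the slow step differs from z by terms in w1 and w0 only, so <z, b> controls
   |b|^2, hence |l|^2, up to quantities that the energy damps. *)
have zbE : z = b + (eta^-1 *: (invS_tr *m w1) - invS_tr *m drift1 w1 w0).
  by rewrite /z /b /slow; apply/colP => i; rewrite !mxE; ring.
set e := eta^-1 *: _ - _ in zbE.
have n1_ge0 := sq_ge0 w1; have n0_ge0 := sq_ge0 w0; have nl_ge0 := sq_ge0 l.
set n1 := sq w1 in n1_ge0 dr1 dr0 da01 sS Sw1 SSw1 Tw1 es *.
set n0 := sq w0 in n0_ge0 dr1 dr0 d00 es *.
set nl := sq l in nl_ge0 Sl es *.
have KK : K <= K ^+ 2 by rewrite expr2; nra.
have Tr2 : sq (invS_tr *m drift1 w1 w0) <= K ^+ 2 * (n1 + n0).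
  by apply: le_trans Tr _; rewrite expr2 -mulrA ler_wpM2l // ltW.
have e_le : sq e <= 4 * K ^+ 2 * (n1 + n0).
  have := sqD_le (eta^-1 *: (invS_tr *m w1)) (- (invS_tr *m drift1 w1 w0)).
  rewrite sqZ -/e.
  have -> : sq (- (invS_tr *m drift1 w1 w0)) = sq (invS_tr *m drift1 w1 w0).
    by rewrite /sq dotNl dotNr opprK.
  have : eta^-1 ^+ 2 * sq (invS_tr *m w1) <= 1 * (K * n1).
    apply: ler_pM; rewrite ?sq_ge0 ?sqr_ge0 //.
    by rewrite expr_le1 ?invr_ge0 ?(ltW eta0') // invf_le1 //; lra.
  have : K * n1 <= K ^+ 2 * n1 by rewrite ler_wpM2r.
  have : 0 <= K ^+ 2 * n0 by rewrite mulr_ge0 // sqr_ge0.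
  by lra.
have b_ge : nl / 2 - K ^+ 2 * (n1 + n0) <= sq b.
  have := sqD_le b (- (invS_tr *m drift1 w1 w0)).
  have -> : sq (- (invS_tr *m drift1 w1 w0)) = sq (invS_tr *m drift1 w1 w0).
    by rewrite /sq dotNl dotNr opprK.
  by rewrite /b addrK -/nl; lra.
have zb_ge : nl / 4 - 5 * K ^+ 2 * (n1 + n0)
    <= 2 * dot z b - (mu / eta) * sq b.
  have -> : dot z b = sq b + dot e b by rewrite zbE dotDl.
  have /andP[h _] := dot_bounds e b ltr01.
  have : mu / eta * sq b <= 1 / 2 * sq b.
    rewrite ler_wpM2r ?sq_ge0 // ler_pdivrMr //.
    by nra.
  have : 0 <= K ^+ 2 * (n1 + n0) by rewrite mulr_ge0 ?sqr_ge0 // addr_ge0.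
  have := sq_ge0 b.
  move: h; rewrite invr1 !mul1r; lra.
have first_order : c * eta * n1 + c * n0 <=
    2 * dot w1 (drift1 w1 w0) + 2 * eta * sq (S *m w1)
    + 2 * dot w0 (A01 *m w1) + 2 * dot w0 (A00 *m w0).
  have M1 : M^-1 * K = c / 4 by rewrite ME; field; rewrite cn0.
  have /andP[h1 _] := dot_bounds w1 (drift1 w1 w0) M0.
  have c4 : 0 < c / 4 by lra.
  have /andP[h2 _] := dot_bounds w0 (A01 *m w1) c4.
  have : M^-1 * sq (drift1 w1 w0) <= c / 4 * (n1 + n0).
    by rewrite -M1 -mulrA ler_wpM2l // invr_ge0 ltW.
  have : (c / 4)^-1 * sq (A01 *m w1) <= M * n1.
    have -> : M * n1 = (c / 4)^-1 * (K * n1) by rewrite ME; field.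
    by rewrite ler_wpM2l // invr_ge0 ltW.
  have : eta * (c * n1) <= eta * sq (S *m w1) by rewrite ler_wpM2l // ltW.
  have : (c / 4 + 2 * M) * n1 <= c * eta * n1 by rewrite ler_wpM2r.
  have : 0 <= c * n0 by rewrite mulr_ge0 // ltW.
  by move: h1 h2; rewrite -/n1 -/n0; lra.
have second_order :
    sq (drift1 w1 w0 + eta *: (S^T *m (S *m w1)) + S^T *m l)
    + sq (S *m w1) + sq (drift0 w1 w0) <= 9 * K * (eta ^+ 2 * n1 + n0 + nl).
  have := sqD3_le (drift1 w1 w0) (eta *: (S^T *m (S *m w1))) (S^T *m l).
  rewrite sqZ.
  have : eta ^+ 2 * sq (S^T *m (S *m w1)) <= eta ^+ 2 * (K * n1).
    by rewrite ler_wpM2l // sqr_ge0.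
  have : K * n1 <= eta ^+ 2 * (K * n1).
    rewrite ler_peMl ?mulr_ge0 ?(ltW K0) //.
    by rewrite exprn_ege1 //; lra.
  have : 0 <= K * n1 by rewrite mulr_ge0 // ltW.
  have : 0 <= K * n0 by rewrite mulr_ge0 // ltW.
  have : 0 <= K * nl by rewrite mulr_ge0 // ltW.
  by lra.
(* Smallness of mu eta trades one power of eta: mu eta^2 |w1|^2 <= delta eta |w1|^2. *)
have mu_le : mu * (eta ^+ 2 * n1 + n0 + nl) <= delta * (eta * n1 + n0 + nl).
  have : mu * eta * (eta * n1) <= delta * (eta * n1).
    by rewrite ler_wpM2r // mulr_ge0 // ltW.
  have mud : mu <= delta.
    by apply: le_trans mueta; rewrite ler_peMr ?(ltW mu0) //; lra.
  have : mu * n0 <= delta * n0 by rewrite ler_wpM2r.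
  have : mu * nl <= delta * nl by rewrite ler_wpM2r.
  by lra.
(* Scalar form of the conclusion: T1 and D2 are the first- and second-order parts of the energy
   decrease, Zb belongs to the slow mode, where the factors eta and 1 / eta cancel. *)
have lyapE : forall Sa T1 D2 Zb s1 s2 s3, n1 + n0 + nl - (s1 + s2 + s3) =
     mu * T1 - mu ^+ 2 * D2 -> c * eta * n1 + c * n0 <= T1 ->
    D2 <= 9 * K * (eta ^+ 2 * n1 + n0 + nl) ->
    nl / 4 - 5 * K ^+ 2 * (n1 + n0) <= Zb ->
    kappa / 8 * (mu * dissip eta w1 w0 l) <= n1 + n0 + nl + kappa * eta * Sa -
      (s1 + s2 + s3 + kappa * eta * (Sa - mu / eta * Zb)).
  move=> Sa T1 D2 Zb s1 s2 s3 h hT hD hZ.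
  have -> : n1 + n0 + nl + kappa * eta * Sa -
      (s1 + s2 + s3 + kappa * eta * (Sa - mu / eta * Zb)) =
      mu * (T1 - mu * D2 + kappa * Zb).
    have -> : kappa * eta * (Sa - mu / eta * Zb) =
      kappa * eta * Sa - kappa * mu * Zb by field.
    by transitivity (n1 + n0 + nl - (s1 + s2 + s3) + kappa * mu * Zb);
      [ring | rewrite h; ring].
  rewrite mulrCA ler_wpM2l ?(ltW mu0) // /dissip -/n1 -/n0 -/nl.
  have : kappa * (nl / 4 - 5 * K ^+ 2 * (n1 + n0)) <= kappa * Zb.
    by rewrite ler_wpM2l // ltW.
  have -> : kappa * (nl / 4 - 5 * K ^+ 2 * (n1 + n0)) =
    kappa * nl / 4 - kappa * (5 * K ^+ 2) * (n1 + n0) by ring.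
  rewrite kapK.
  have : mu * D2 <= kappa / 8 * (eta * n1 + n0 + nl).
    apply: (@le_trans _ _ (9 * K * (delta * (eta * n1 + n0 + nl)))).
      apply: (@le_trans _ _ (mu * (9 * K * (eta ^+ 2 * n1 + n0 + nl)))).
        by rewrite ler_wpM2l // ltW.
      by rewrite mulrCA ler_wpM2l // mulr_ge0 // ltW.
    by rewrite mulrA deltaK.
  have : c * n1 <= c * (eta * n1).
    by rewrite ler_wpM2l ?(ltW c0) // ler_peMl //; lra.
  have : kappa * (eta * n1) <= c / 20 * (eta * n1).
    by rewrite ler_wpM2r // mulr_ge0 // ltW.
  have : kappa * n0 <= c / 20 * n0 by rewrite ler_wpM2r.
  have : 0 <= c * n1 by rewrite mulr_ge0 // ltW.
  have : 0 <= c * n0 by rewrite mulr_ge0 // ltW.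
  have : 0 <= kappa * nl by rewrite mulr_ge0 // ltW.
  by lra.
rewrite (sq_subZ (mu / eta) z b).
exact: lyapE es first_order second_order zb_ge.
Qed.

(** * The corrector and its defect *)

Lemma P_sym : P^T = P.
Proof. by rewrite trmx_inv A00_sym. Qed.

(** The first-order terms <w0, P A01 w1> from the two parts of [corrector] cancel by [coupleK];
    everything left carries mu^2 or mu / eta. *)
Lemma corrector_step mu eta w1 w0 l : eta != 0 ->
  corrector eta w1 w0
    - corrector eta (step1 mu eta w1 w0 l) (step0 mu w1 w0) - 2 * mu * sq w0 =
  - (mu ^+ 2 * dot (drift0 w1 w0) (P *m drift0 w1 w0)
     + 2 * (mu / eta) * (dot w0 (couple *m drift1 w1 w0)
        + dot w0 (couple *m (S^T *m l))
        + dot (drift0 w1 w0) (couple *m step1 mu eta w1 w0 l))).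
Proof.
move=> eta0; rewrite /corrector.
have Pr : P *m drift0 w1 w0 = P *m A01 *m w1 + w0.
  by rewrite mulmxDr mulmxA mulKmx ?A00_unit.
have rP : dot (drift0 w1 w0) (P *m w0) = dot w0 (P *m drift0 w1 w0).
  by rewrite [LHS]dotC dot_mulmxl P_sym.
have cS : couple *m step1 mu eta w1 w0 l = couple *m w1 - mu *:
   (couple *m drift1 w1 w0 + eta *: (P *m A01 *m w1) + couple *m (S^T *m l)).
  by rewrite mulmxBr -scalemxAr !mulmxDr -scalemxAr -coupleK !mulmxA.
have -> : dot (step0 mu w1 w0) (couple *m step1 mu eta w1 w0 l) =
    dot w0 (couple *m step1 mu eta w1 w0 l)
    - mu * dot (drift0 w1 w0) (couple *m step1 mu eta w1 w0 l).
  by rewrite [in LHS]/step0 dotDl dotNl dotZl.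
have -> : dot w0 (couple *m step1 mu eta w1 w0 l) = dot w0 (couple *m w1)
   - mu * (dot w0 (couple *m drift1 w1 w0) + eta * dot w0 (P *m A01 *m w1)
     + dot w0 (couple *m (S^T *m l))).
  by rewrite cS dotDr dotNr dotZr !dotDr dotZr.
have -> : dot (step0 mu w1 w0) (P *m step0 mu w1 w0) = dot w0 (P *m w0)
   - 2 * mu * (dot w0 (P *m A01 *m w1) + sq w0)
   + mu ^+ 2 * dot (drift0 w1 w0) (P *m drift0 w1 w0).
  rewrite /step0 mulmxBr -scalemxAr dotDl !dotDr !dotNl !dotNr !dotZl !dotZr rP.
  by rewrite {1 2}Pr dotDr -/(sq w0); ring.
by field.
Qed.

Lemma corrector_defect : exists2 C, 0 < C &
  forall mu eta w1 w0 l, 1 <= eta -> 0 < mu -> mu * eta <= 1 ->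
    `|corrector eta w1 w0 - corrector eta (step1 mu eta w1 w0 l)
        (step0 mu w1 w0) - 2 * mu * (sq w1 + sq w0)|
    <= C / eta * (mu * dissip eta w1 w0 l).
Proof.
have [K [c [[K1 _ _] [B1 [B2 [B3 B4]]]]]] := block_bounds.
have K0 : 0 <= K by lra.
(* 40 K^2 is a generous bound for the remainders of [corrector_step]; the 2 pays for 2 mu |w1|^2,
   which is 2 / eta times mu eta |w1|^2. *)
exists (40 * K ^+ 2 + 2); first by rewrite ltr_wpDl // mulr_ge0 // sqr_ge0.
move=> mu eta w1 w0 l eta1 mu0 mueta.
have eta0 : 0 < eta by lra.
have [dr1 dr0 _ _ _] := B1 w1 w0.
have [_ _ SSw1 _] := B2 w1.
have [_ Sl _ _] := B2 l.
have [Cr _] := B3 (drift1 w1 w0).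
have [_ Cl] := B3 l.
have [C1 _] := B3 (step1 mu eta w1 w0 l).
have Pr := B4 (drift0 w1 w0).
have step := corrector_step mu w1 w0 l (lt0r_neq0 eta0).
have := dot_bounds (drift0 w1 w0) (P *m drift0 w1 w0) ltr01.
have := dot_bounds w0 (couple *m drift1 w1 w0) ltr01.
have := dot_bounds w0 (couple *m (S^T *m l)) ltr01.
have := dot_bounds (drift0 w1 w0) (couple *m step1 mu eta w1 w0 l) ltr01.
(* As mu eta <= 1, the penalty step stays bounded and the next w1 is controlled uniformly in eta. *)
have s1 : sq (step1 mu eta w1 w0 l) <= 14 * K * (sq w1 + sq w0 + sq l).
  rewrite /step1; set a := _ + S^T *m l.
  have := sqD_le w1 (- (mu *: a)); rewrite -scaleNr sqZ sqrrN.
  have : mu ^+ 2 * sq a <= 3 * K * (2 * sq w1 + sq w0 + sq l).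
    have := sqD3_le (drift1 w1 w0) (eta *: (S^T *m (S *m w1))) (S^T *m l).
    rewrite -/a sqZ => ha.
    have ha2 : sq a <= 3 * K * (eta ^+ 2 * sq w1 + (sq w1 + sq w0 + sq l)).
      apply: le_trans ha _; rewrite -mulrA ler_wpM2l // mulrDr.
      have : eta ^+ 2 * sq (S^T *m (S *m w1)) <= eta ^+ 2 * (K * sq w1).
        by rewrite ler_wpM2l // sqr_ge0.
      by lra.
    have mu1 : mu <= 1 by apply: le_trans mueta; rewrite ler_peMr ?(ltW mu0).
    apply: (@le_trans _ _ (mu ^+ 2 * (3 * K * (eta ^+ 2 * sq w1 +
        (sq w1 + sq w0 + sq l))))); first by rewrite ler_wpM2l // sqr_ge0.
    rewrite mulrCA ler_wpM2l ?mulr_ge0 // mulrDr mulrA -exprMn.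
    have : (mu * eta) ^+ 2 * sq w1 <= 1 * sq w1.
      by rewrite ler_wpM2r ?sq_ge0 // expr_le1 // mulr_ge0 // ltW.
    have : mu ^+ 2 * (sq w1 + sq w0 + sq l) <= 1 * (sq w1 + sq w0 + sq l).
      by rewrite ler_wpM2r ?addr_ge0 ?sq_ge0 // expr_le1 ?(ltW mu0).
    by lra.
  have : sq w1 <= K * sq w1 by rewrite ler_peMl ?sq_ge0.
  have := mulr_ge0 K0 (sq_ge0 w0); have := mulr_ge0 K0 (sq_ge0 l).
  by lra.
rewrite invr1 !mul1r.
have -> : corrector eta w1 w0 - corrector eta (step1 mu eta w1 w0 l)
      (step0 mu w1 w0) - 2 * mu * (sq w1 + sq w0) =
    corrector eta w1 w0 - corrector eta (step1 mu eta w1 w0 l)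
      (step0 mu w1 w0) - 2 * mu * sq w0 - 2 * mu * sq w1 by ring.
rewrite step /dissip.
have n1_ge0 := sq_ge0 w1; have n0_ge0 := sq_ge0 w0; have nl_ge0 := sq_ge0 l.
clear step B1 B2 B3 B4 SSw1 Sl.
move: (dot _ (P *m _)) (dot w0 (couple *m drift1 _ _)) (dot w0 (couple *m _)).
move: (dot _ (couple *m _)) => d4 d1 d2 d3.
move: (sq (P *m _)) (sq (couple *m drift1 _ _)) Pr Cr => qP qr Pr Cr.
move: (sq (couple *m (S^T *m _))) Cl => ql Cl.
move: (sq (couple *m _)) (sq (step1 _ _ _ _ _)) C1 s1 => qs q1 C1 s1.
move: (sq (drift0 _ _)) (sq (drift1 _ _)) dr0 dr1 Pr Cr => s0 r1 dr0 dr1 Pr Cr.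
move: (sq w1) (sq w0) (sq l) n1_ge0 n0_ge0 nl_ge0 dr0 dr1 s1 Cl.
move=> n1 n0 nl n1_ge0 n0_ge0 nl_ge0 dr0 dr1 s1 Cl.
move=> /andP[l4 u4] /andP[l3 u3] /andP[l2 u2] /andP[l1 u1].
pose n := n1 + n0 + nl; pose nu := mu / eta.
have n_ge0 : 0 <= n by rewrite !addr_ge0.
have nu0 : 0 < nu by rewrite divr_gt0.
have nuE : nu * eta = mu by rewrite /nu divfK // gt_eqF.
(* Again by mu eta <= 1: the quadratic remainder is no larger than the mu / eta terms. *)
have nu_sq : mu ^+ 2 <= nu.
  by rewrite expr2 -{1}nuE -mulrA ler_piMr ?(ltW nu0) // mulrC.
have K_sq : K <= K ^+ 2 by rewrite expr2 ler_peMl.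
have Kn : 0 <= K * n <= K ^+ 2 * n by rewrite mulr_ge0 ?ler_wpM2r.
have nK : n <= K * n by rewrite ler_peMl.
have b1 : s0 <= K * n /\ r1 <= K * n.
  by have := mulr_ge0 K0 nl_ge0; rewrite /n; lra.
have b2 : K * s0 <= K ^+ 2 * n /\ K * r1 <= K ^+ 2 * n.
  by rewrite expr2 -mulrA; split; rewrite ler_wpM2l //; case: b1.
have b3 : K * q1 <= 14 * K ^+ 2 * n.
  have -> : 14 * K ^+ 2 * n = K * (14 * K * n) by ring.
  by rewrite ler_wpM2l.
have b4 : K * nl <= K * n by rewrite ler_wpM2l // /n; lra.
have b5 : n0 <= n by rewrite /n; lra.
have q1' : `|2 * d1| <= 2 * (K ^+ 2 * n) by rewrite ler_norml; lra.
have q2 : `|2 * (d2 + d3 + d4)| <= 38 * (K ^+ 2 * n) by rewrite ler_norml; lra.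
have -> : (40 * K ^+ 2 + 2) / eta * (mu * (eta * n1 + n0 + nl)) =
    nu * ((40 * K ^+ 2 + 2) * (eta * n1 + n0 + nl)) by rewrite /nu; ring.
have -> : 2 * mu * n1 = 2 * (nu * eta) * n1 by rewrite nuE.
rewrite -/nu; clearbody nu.
set X := 2 * d1 in q1' *; set Y := 2 * (_ + _ + _) in q2 *.
have -> : - (mu ^+ 2 * d1 + 2 * nu * (d2 + d3 + d4)) - 2 * (nu * eta) * n1 =
    - (mu ^+ 2 / 2 * X + nu * (Y + 2 * (eta * n1))) by rewrite /X /Y; field.
rewrite normrN; apply: le_trans (ler_normD _ _) _.
have mu2_ge0 : 0 <= mu ^+ 2 / 2 by rewrite divr_ge0 ?sqr_ge0.
have e1_ge0 : 0 <= eta * n1 by rewrite mulr_ge0 // ltW.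
rewrite (normrM nu) (normrM (_ / _)) (gtr0_norm nu0) (ger0_norm mu2_ge0).
have : mu ^+ 2 / 2 * `|X| <= nu / 2 * (2 * (K ^+ 2 * n)).
  by rewrite ler_pM // ler_wpM2r ?invr_ge0.
have : nu * `|Y + 2 * (eta * n1)| <= nu * (38 * (K ^+ 2 * n) + 2 * (eta * n1)).
  rewrite ler_wpM2l ?(ltW nu0) //; apply: le_trans (ler_normD _ _) _.
  have e2_ge0 : 0 <= 2 * (eta * n1) by rewrite mulr_ge0.
  by rewrite (ger0_norm e2_ge0) lerD.
have n_le : n <= eta * n1 + n0 + nl by rewrite /n !lerD2r ler_peMl.
have : nu * (40 * (K ^+ 2 * n) + 2 * (eta * n1)) <=
    nu * ((40 * K ^+ 2 + 2) * (eta * n1 + n0 + nl)).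
  apply: ler_wpM2l; first exact: ltW.
  have : K ^+ 2 * n <= K ^+ 2 * (eta * n1 + n0 + nl).
    by rewrite ler_wpM2l ?sqr_ge0.
  by lra.
have : 0 <= nu * (K ^+ 2 * n) by rewrite !mulr_ge0 ?sqr_ge0 ?(ltW nu0).
by lra.
Qed.

(** * The iteration in matrix form and its summed energy *)

Definition saddle_mx eta : 'M[R]_(p + q + p) :=
  block_mx (block_mx (A11 + eta *: (S^T *m S)) A10 A01 A00)
           (col_mx S^T 0) (row_mx (- S) 0) 0.

Definition iter_mx mu eta : 'M[R]_(p + q + p) := 1%:M - mu *: saddle_mx eta.

Lemma iter_mx_col mu eta w1 w0 l :
  iter_mx mu eta *m col_mx (col_mx w1 w0) l =
  col_mx (col_mx (step1 mu eta w1 w0 l) (step0 mu w1 w0)) (stepl mu w1 l).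
Proof.
rewrite mulmxBl mul1mx -scalemxAl /saddle_mx !mul_block_col mul_row_col.
rewrite mul_col_mx !mul0mx !addr0 mulmxDl -scalemxAl -mulmxA mulNmx.
rewrite add_col_mx addr0 !scale_col_mx !opp_col_mx !add_col_mx scalerN opprK.
congr (col_mx (col_mx _ _) _).
by rewrite /step1 /drift1 (addrAC (A11 *m w1)).
Qed.

Lemma block_quad_form (A : 'M[R]_q) (y : 'cV[R]_(p + q)) :
  dot y (block_mx 0 0 0 A *m y) = dot (dsubmx y) (A *m dsubmx y).
Proof.
rewrite -{1 2}[y]vsubmxK mul_block_col !mul0mx !add0r /dot tr_col_mx.
by rewrite mul_row_col mulmx0 add0r.
Qed.

(** [telescoping_estimate] along the trajectory from (y, 0), with [lyap] as L and [corrector] as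
    j. *)
Lemma iterates_estimate : exists C delta eta0,
  [/\ 0 < C, 0 < delta & 1 <= eta0] /\
  forall mu eta, eta0 <= eta -> 0 < mu -> mu * eta <= delta ->
  forall y : 'cV[R]_(p + q),
    let f := series (fun n => sq (usubmx (iter_mx mu eta ^+ n *m col_mx y 0))) in
    cvgn f /\ `|2 * mu * limn f - dot y (block_mx 0 0 0 P *m y)|
              <= C / eta * sq y.
Proof.
have [c [kappa [delta [eta0 [[c0 kap0 /andP[del0 del1] eta01] decr]]]]] :=
  lyapunov_decrease.
have [C C0 defect] := corrector_defect.
have [K [_ [[K1 _ _] [_ [B2 [B3 B4]]]]]] := block_bounds.
have K0 : 0 <= K by lra.
(* The first summand is the accumulated defect, C / c times the bound on the initial [lyap]; the
   second is the gap between [corrector] and <w0, P w0> at time 0. *)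
exists (C / c * (1 + kappa * K) + (1 + K)), delta, eta0; split.
  split=> //; apply: addr_gt0; last by lra.
  rewrite mulr_gt0 ?divr_gt0 //; have := mulr_ge0 (ltW kap0) K0.
  by lra.
move=> mu eta eta_ge mu0 mueta y f.
have eta1 : 1 <= eta by apply: le_trans eta_ge.
have eta_gt0 : 0 < eta by lra.
pose x n := iter_mx mu eta ^+ n *m col_mx y 0.
pose x1 n := usubmx (usubmx (x n)); pose x0 n := dsubmx (usubmx (x n)).
pose xl n := dsubmx (x n).
have xE n : x n = col_mx (col_mx (x1 n) (x0 n)) (xl n) by rewrite !vsubmxK.
have xS n : x n.+1 = col_mx (col_mx (step1 mu eta (x1 n) (x0 n) (xl n))
    (step0 mu (x1 n) (x0 n))) (stepl mu (x1 n) (xl n)).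
  by rewrite -iter_mx_col -xE /x exprS mulmxA.
have x1S n : x1 n.+1 = step1 mu eta (x1 n) (x0 n) (xl n).
  by rewrite /x1 xS !col_mxKu.
have x0S n : x0 n.+1 = step0 mu (x1 n) (x0 n).
  by rewrite /x0 xS col_mxKu col_mxKd.
have xlS n : xl n.+1 = stepl mu (x1 n) (xl n) by rewrite /xl xS col_mxKd.
have x00 : x 0 = col_mx y 0 by rewrite /x expr0 mul1mx.
have sqE n : sq (usubmx (x n)) = sq (x1 n) + sq (x0 n).
  by rewrite xE col_mxKu sq_col_mx.
pose L n := lyap kappa eta (x1 n) (x0 n) (xl n).
pose j n := corrector eta (x1 n) (x0 n).
have L_ge0 n : 0 <= L n.
  by rewrite /L /lyap !addr_ge0 ?sq_ge0 // !mulr_ge0 ?sq_ge0 ?ltW.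
have LS n : c * (mu * dissip eta (x1 n) (x0 n) (xl n)) <= L n - L n.+1.
  by rewrite /L x1S x0S xlS; apply: decr.
have dis n : sq (usubmx (x n)) <= dissip eta (x1 n) (x0 n) (xl n).
  rewrite sqE /dissip; have := sq_ge0 (xl n).
  have : sq (x1 n) <= eta * sq (x1 n) by rewrite ler_peMl ?sq_ge0.
  by lra.
have corr_le w1 w0 : `|corrector eta w1 w0 - dot w0 (P *m w0)|
    <= (1 + K) / eta * (sq w1 + sq w0).
  rewrite /corrector addrAC subrr sub0r normrN -mulrA (mulrCA 2) normrM.
  rewrite gtr0_norm ?invr_gt0 // [_ / eta]mulrC -mulrA.
  rewrite ler_wpM2l ?invr_ge0 ?(ltW eta_gt0) //.
  rewrite normrM ger0_norm //; have := dot_norm_le w0 (couple *m w1).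
  have [h _] := B3 w1; have := mulr_ge0 K0 (sq_ge0 w0); have := sq_ge0 w1.
  by lra.
(* A crude bound, uniform in eta, which serves to send j n to 0. *)
have jk n : `|j n| <= (1 + K + 1 + K) * sq (usubmx (x n)).
  rewrite sqE /j; have := corr_le (x1 n) (x0 n).
  have := dot_norm_le (x0 n) (P *m x0 n); have := B4 (x0 n).
  set d := dot _ _ => h1 h2 h3.
  rewrite -[corrector _ _ _](subrK d); apply: le_trans (ler_normD _ _) _.
  have : (1 + K) / eta * (sq (x1 n) + sq (x0 n)) <=
      (1 + K) * (sq (x1 n) + sq (x0 n)).
    rewrite ler_wpM2r ?addr_ge0 ?sq_ge0 // ler_pdivrMr // ler_peMr //; lra.
  have := mulr_ge0 K0 (sq_ge0 (x1 n)); have := sq_ge0 (x1 n).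
  have := sq_ge0 (x0 n); have := normr_ge0 d.
  by lra.
have aL n : c * mu * sq (usubmx (x n)) <= L n - L n.+1.
  apply: le_trans (LS n); rewrite -mulrA ler_wpM2l ?(ltW c0) //.
  by rewrite ler_wpM2l ?(ltW mu0).
have jL n : `|j n - j n.+1 - 2 * mu * sq (usubmx (x n))|
    <= C / c / eta * (L n - L n.+1).
  rewrite sqE /j x1S x0S.
  apply: le_trans (defect mu eta (x1 n) (x0 n) (xl n) eta1 mu0 _) _.
    exact: le_trans mueta del1.
  have -> : C / eta * (mu * dissip eta (x1 n) (x0 n) (xl n)) =
      C / c / eta * (c * (mu * dissip eta (x1 n) (x0 n) (xl n))).
    by field; rewrite !gt_eqF.
  by rewrite ler_wpM2l // !divr_ge0 // ltW.
have e_ge0 : 0 <= C / c / eta by rewrite !divr_ge0 // ltW.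
have [cf lim_le] := telescoping_estimate (mulr_gt0 c0 mu0) e_ge0
  (fun n => sq_ge0 _) L_ge0 aL jL jk.
split=> //.
have x10 : x1 0 = usubmx y by rewrite /x1 x00 col_mxKu.
have x0y : x0 0 = dsubmx y by rewrite /x0 x00 col_mxKu.
have xl0 : xl 0 = 0 by rewrite /xl x00 col_mxKd.
have yE : sq y = sq (x1 0) + sq (x0 0) by rewrite x10 x0y -sq_col_mx vsubmxK.
rewrite block_quad_form -x0y.
(* Since l starts at 0, the slow mode is eta^-1 S^-T w1 and kappa eta |[slow]|^2 is of order 1 /
   eta, so the large weight does no harm at time 0. *)
have L0_le : L 0 <= (1 + kappa * K) * sq y.
  rewrite /L /lyap /slow xl0 add0r sqZ -yE.
  have -> : sq (0 : 'cV[R]_p) = 0 by rewrite /sq /dot mulmx0 mxE.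
  rewrite addr0 mulrDl mul1r lerD2l.
  have -> : kappa * eta * (eta^-1 ^+ 2 * sq (invS_tr *m x1 0)) =
      kappa * (eta^-1 * sq (invS_tr *m x1 0)) by field; rewrite gt_eqF.
  rewrite -mulrA ler_wpM2l ?(ltW kap0) //.
  apply: (@le_trans _ _ (1 * sq (invS_tr *m x1 0))).
    by rewrite ler_wpM2r ?sq_ge0 // invf_le1.
  rewrite mul1r; have [_ _ _ h] := B2 (x1 0); apply: le_trans h _.
  by rewrite ler_wpM2l // yE lerDl sq_ge0.
have := corr_le (x1 0) (x0 0); rewrite -yE -/(j 0).
have : C / c / eta * L 0 <= C / c / eta * ((1 + kappa * K) * sq y).
  by rewrite ler_wpM2l.
move: lim_le; set lm := 2 * mu * _ => h1 h2 h3.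
rewrite -(subrK (j 0) lm) -addrA; apply: le_trans (ler_normD _ _) _.
have -> : (C / c * (1 + kappa * K) + (1 + K)) / eta * sq y =
   C / c / eta * ((1 + kappa * K) * sq y) + (1 + K) / eta * sq y by ring.
by apply: lerD h3; apply: le_trans h2.
Qed.

End SaddlePoint.

(** * Return to the network: Kronecker blocks and the trace formula *)

Lemma tens_mx1 (R : comPzRingType) (m n : nat) :
  (1%:M : 'M[R]_m) *t (1%:M : 'M[R]_n) = 1%:M.
Proof.
apply/matrixP => i j.
case: (mxtens_indexP i) => i0 i1; case: (mxtens_indexP j) => j0 j1.
rewrite tensmxE !mxE (can_eq (@mxtens_indexK m n)) xpair_eqE -natrM.
by rewrite mulnb.
Qed.

Lemma calS2_unit (R : realType) (N M : nat) (s : 'rV[R]_N.-1) :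
  (forall j, 0 < s 0 j) -> calS2 M s \in unitmx.
Proof.
move=> s_gt0.
apply: (@mulmx1_unit _ _ _ (diag_mx (map_mx GRing.inv s) *t 1%:M) _).1.
rewrite tensmx_mul mulmx_diag mulmx1 -tens_mx1; congr (_ *t _).
rewrite -diag_const_mx; congr diag_mx; apply/rowP => j.
by rewrite !mxE mulfV // gt_eqF.
Qed.

(** Each block contributes u^T E_kk u = 1 / N with u = 1_N / sqrt N; the mixed-product rule for
    Kronecker products reduces to this. *)
Lemma blockdiag_mean (R : realType) (N M : nat) (A : 'I_N -> 'M[R]_M) :
  (calV0 R N M)^T *m blockdiag A *m calV0 R N M = N%:R^-1 *: \sum_k A k.
Proof.
rewrite /blockdiag mulmx_sumr mulmx_suml scaler_sumr; apply: eq_bigr => k _.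
have uku : (unit_ones R N)^T *m delta_mx k k *m unit_ones R N = N%:R^-1%:M.
  rewrite -(mul_delta_mx (0 : 'I_1) k k) mulmxA -mulmxA -colE -rowE.
  apply/matrixP => i j; rewrite !ord1 mxE big_ord1 !mxE eqxx mulr1n.
  by rewrite -expr2 exprVn sqr_sqrtr ?ler0n.
rewrite /calV0 trmx_cast trmx_tens trmx1 /=.
have := castmx_mul (mul1n M) (erefl (N * M)%N)
  ((unit_ones R N)^T *t (1%:M : 'M[R]_M)) (delta_mx k k *t A k).
rewrite castmx_id => <-; rewrite -castmx_mul !tensmx_mul mul1mx mulmx1.
by rewrite uku tens_scalar_mx castmx_comp castmx_id.
Qed.

(** [Phi] selects the primal part (w1, w0), so the summands of the MSD become primal energies of
    trajectories with l = 0 at the start. *)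
Lemma Phi_quad_form (R : realType) (N M : nat)
    (Y : 'M[R]_(N.-1 * M + M + N.-1 * M)) y :
  dot y (ulsubmx (Y^T *m Phi R N M *m Y) *m y) = sq (usubmx (Y *m col_mx y 0)).
Proof.
set W := Y^T *m _ *m Y.
have -> : dot y (ulsubmx W *m y) = dot (col_mx y 0) (W *m col_mx y 0).
  rewrite -{2}[W]submxK mul_block_col !mulmx0 !addr0 /dot tr_col_mx trmx0.
  by rewrite mul_row_col mul0mx addr0.
rewrite /W -mulmxA -mulmxA -dot_mulmxl; move: (Y *m _) => v.
rewrite -{1 2}[v]vsubmxK /Phi mul_block_col !mul0mx addr0 mul1mx addr0.
by rewrite /sq /dot tr_col_mx mul_row_col mulmx0 addr0.
Qed.

(** [Rh] vanishes outside its primal block, so the trace sees only the upper-left block of the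
    propagated [Phi]. *)
Lemma MSD_traceE (R : realType) (N M : nat) (s : 'rV[R]_N.-1) V2
    (Ru : 'I_N -> 'M[R]_M) sigma2 (mu eta : R) :
  let B := calB' s V2 Ru mu eta in
  MSD s V2 Ru sigma2 mu eta = mu ^+ 2 / N%:R * limn (series (fun n =>
    \tr ((calV M V2)^T *m calRz Ru sigma2 *m calV M V2 *m
         ulsubmx ((B ^+ n)^T *m Phi R N M *m B ^+ n)))).
Proof.
move=> B; rewrite /MSD; congr (_ * _).
apply: (congr1 (fun u : R^nat => limn (series u))); apply/funext => n.
rewrite -/B.
have BT : B^T ^+ n = (B ^+ n)^T.
  elim: n => [|n IH]; first by rewrite !expr0 trmx1.
  by rewrite exprSr exprS IH; exact: esym (trmx_mul _ _).
rewrite /mk_sequence BT; set W := (B ^+ n)^T *m _ *m _.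
have -> : Rh V2 Ru sigma2 *m (B ^+ n)^T *m Phi R N M *m B ^+ n =
    Rh V2 Ru sigma2 *m W by rewrite /W !mulmxA.
rewrite -{1}[W]submxK /Rh mulmx_block mxtrace_block.
by rewrite !mul0mx !addr0 mxtrace0 addr0.
Qed.

(** The limiting form meets only the consensus block of V^T Rz V, which is a mean; its 1 / N cancels
    the N from inverting the mean covariance. *)
Lemma limit_trace (R : realType) (N M : nat) (V2 : 'M[R]_(N, N.-1))
    (Ru : 'I_N -> 'M[R]_M) sigma2 : (0 < N)%N -> \sum_k Ru k \in unitmx ->
  \tr ((calV M V2)^T *m calRz Ru sigma2 *m calV M V2 *m
       block_mx 0 0 0 (invmx (N%:R^-1 *: \sum_k Ru k))) =
  \tr (invmx (\sum_k Ru k) *m (\sum_k sigma2 k *: Ru k)).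
Proof.
move=> N0 Ru_unit.
have Nn0 : N%:R != 0 :> R by rewrite pnatr_eq0 -lt0n.
rewrite /calV tr_row_mx mul_col_mx mul_col_row mulmx_block mxtrace_block.
rewrite !mulmx0 !add0r mxtrace0 add0r blockdiag_mean invmxZ; last first.
  by rewrite unitmxZ // unitfE invr_eq0.
rewrite invrK -scalemxAl -scalemxAr scalerA mulVf // scale1r.
by rewrite mxtrace_mulC.
Qed.

Lemma MSD_estimate (R : realType) (N M : nat) (s : 'rV[R]_N.-1)
    (V2 : 'M[R]_(N, N.-1)) (Ru : 'I_N -> 'M[R]_M) (sigma2 : 'I_N -> R) :
  (0 < N)%N -> (forall j, 0 < s 0 j) -> pdmx (\sum_k Ru k) ->
  exists C delta eta0, [/\ 0 <= C, 0 < delta & 1 <= eta0] /\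
  forall mu eta, eta0 <= eta -> 0 < mu -> mu * eta <= delta ->
    `|MSD s V2 Ru sigma2 mu eta - mu / (2 * N%:R) *
        \tr (invmx (\sum_k Ru k) *m (\sum_k sigma2 k *: Ru k))|
    <= C * (mu / eta).
Proof.
move=> N0 s_gt0 [Ru_sym Ru_pos].
have N_gt0 : 0 < N%:R :> R by rewrite ltr0n.
have Ru_dot x : x != 0 -> 0 < dot x ((\sum_k Ru k) *m x).
  by move=> /Ru_pos; rewrite -mulmxA.
have A00_sym : (N%:R^-1 *: \sum_k Ru k)^T = N%:R^-1 *: \sum_k Ru k.
  by rewrite linearZ /= Ru_sym.
have A00_pos x : x != 0 -> 0 < dot x ((N%:R^-1 *: \sum_k Ru k) *m x).
  by move=> x0; rewrite -scalemxAl dotZr mulr_gt0 ?invr_gt0 ?Ru_dot.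
pose A11 := (calV2 M V2)^T *m calH Ru *m calV2 M V2.
pose A10 := (calV2 M V2)^T *m calH Ru *m calV0 R N M.
pose A01 := (calV0 R N M)^T *m calH Ru *m calV2 M V2.
have [C [delta [eta0 [[C0 del0 eta01] est]]]] :=
  iterates_estimate A11 A10 A01 (calS2_unit M s_gt0) A00_sym A00_pos.
pose K := (calV M V2)^T *m calRz Ru sigma2 *m calV M V2.
pose SK := \sum_i \sum_j `|K i j|.
have SK0 : 0 <= SK by do 2!(apply: sumr_ge0 => ? _).
exists (C * SK / (2 * N%:R)), delta, eta0; split.
  split=> //; first by rewrite divr_ge0 ?mulr_ge0 // ltW.
move=> mu eta eta_ge mu0 mueta.
rewrite MSD_traceE -(limit_trace V2 sigma2 N0 (pos_def_unitmx Ru_dot)) -/K.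
set B := calB' _ _ _ _ _; set Q := block_mx _ _ _ _.
have Q_sym : Q^T = Q by rewrite /Q tr_block_mx !trmx0 trmx_inv A00_sym.
pose Z n := ulsubmx ((B ^+ n)^T *m Phi R N M *m B ^+ n).
have Z_sym n : (Z n)^T = Z n.
  rewrite /Z trmx_ulsub !trmx_mul trmxK mulmxA; congr (ulsubmx (_ *m _ *m _)).
  by rewrite /Phi tr_block_mx !trmx0 trmx1.
have h := @trace_series_estimate _ _ K Q Z (2 * mu) (C / eta) Q_sym Z_sym.
have {}h : `|2 * mu * limn (series (fun n => \tr (K *m Z n))) - \tr (K *m Q)|
    <= C / eta * SK.
  apply: h => y; have -> : (fun n => dot y (Z n *m y)) =
      (fun n => sq (usubmx (B ^+ n *m col_mx y 0))).
    by apply/funext => n; rewrite Phi_quad_form.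
  (* [calB'] is definitionally [iter_mx] for these blocks. *)
  exact: est.
(* Splitting mu^2 / N as mu / (2 N) times 2 mu isolates the quantity known up to O(1 / eta); the
   other factor turns this into O(mu / eta). *)
have -> : mu ^+ 2 / N%:R * limn (series (fun n => \tr (K *m Z n)))
    - mu / (2 * N%:R) * \tr (K *m Q) =
    mu / (2 * N%:R) * (2 * mu * limn (series (fun n => \tr (K *m Z n)))
      - \tr (K *m Q)) by field; rewrite gt_eqF.
have muN : 0 <= mu / (2 * N%:R) by rewrite divr_ge0 ?mulr_ge0 // ltW.
rewrite normrM (ger0_norm muN).
have -> : C * SK / (2 * N%:R) * (mu / eta) = mu / (2 * N%:R) * (C / eta * SK).
  by field; rewrite !gt_eqF //; lra.
by rewrite ler_wpM2l.
Qed.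

Theorem theorem7 (R : realType) (N M : nat) (N_gt0 : (0 < N)%N)
  (adj : rel 'I_N) (adj_sym : symmetric adj) (adj_irr : irreflexive adj)
  (adj_conn : graph_connected adj)
  (U : 'M[R]_#|edges adj|) (s : 'rV[R]_N.-1) (V2 : 'M[R]_(N, N.-1))
  (C_svd : is_svd (incidence R adj) U s V2)
  (Ru : 'I_N -> 'M[R]_M) (sigma2 : 'I_N -> R)
  (Ru_psd : forall k, psdmx (Ru k))
  (sum_Ru_pd : pdmx (\sum_k Ru k))
  (sigma2_ge0 : forall k, 0 <= sigma2 k)
  (theta : R) (theta_gt1 : 1 < theta)
  (stable : \forall eta \near +oo,
    spectral_radius (calB' s V2 Ru (eta `^ (- theta)) eta) < 1) :
  (fun mu : R => MSD s V2 Ru sigma2 mu (mu `^ (- theta^-1)))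
  = (fun mu : R => mu / (2 * N%:R) *
      \tr (invmx (\sum_k Ru k) *m (\sum_k sigma2 k *: Ru k)))
  +O_ (0^'+) (fun mu : R => mu `^ (1 + theta^-1)).
Proof.
have [_ _ s_gt0 _] := C_svd.
have [C [delta [eta0 [[C0 del0 eta01] est]]]] :=
  MSD_estimate V2 sigma2 N_gt0 s_gt0 sum_Ru_pd.
have th0 : 0 < theta by lra.
(* theta > 1 makes the exponent in mu eta = mu^(1 - 1/theta) positive, so mu eta tends to 0. *)
have thi : 0 < 1 - theta^-1 by rewrite subr_gt0 invf_lt1.
have eta0_gt0 : 0 < eta0 by lra.
apply/eqaddOP; near=> k; near=> mu.
have mu0 : 0 < mu by near: mu; exact: nbhs_right_gt.
have pow_le (x a : R) : 0 < x -> 0 < a -> mu <= x `^ a^-1 -> mu `^ a <= x.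
  move=> x0 a0 mux; rewrite -[leRHS]powRr1 ?(ltW x0) // -(@mulVf _ a) ?gt_eqF //.
  by rewrite powRrM ge0_ler_powR ?nnegrE ?powR_ge0 // ltW.
have mu_eta0 : mu `^ theta^-1 <= eta0^-1.
  apply: pow_le; rewrite ?invr_gt0 //.
  by near: mu; apply: nbhs_right_le; rewrite powR_gt0 // invr_gt0.
have mu_delta : mu `^ (1 - theta^-1) <= delta.
  apply: pow_le => //.
  by near: mu; apply: nbhs_right_le; rewrite powR_gt0.
(* The error scale mu / eta is exactly mu^(1 + 1/theta). *)
have powD : mu `^ (1 + theta^-1) = mu / mu `^ (- theta^-1).
  rewrite powRD; last by rewrite (gt_eqF mu0) implybT.
  by rewrite powRr1 ?(ltW mu0) // powRN invrK.
apply: (@le_trans _ _ (C * (mu / mu `^ (- theta^-1)))).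
  apply: est => //.
    by rewrite powRN -[leLHS]invrK lef_pV2 ?posrE ?invr_gt0 ?powR_gt0.
  rewrite -[X in X * _]powRr1 ?(ltW mu0) // -powRD //.
  by rewrite (gt_eqF mu0) implybT.
by rewrite -powD ger0_norm ?powR_ge0 // ler_wpM2r ?powR_ge0.
Unshelve. all: by end_near.
Qed.
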